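(* Let $C = \{n^3 : n \ge 1\}$ be the set of positive cubes. Then $s_C(x) \gg \log\log x$ as $x \to \infty$.
   Context: For a set $C$ of nonnegative integers, $R_C(n)$ is the number of pairs $(c,c')$ with $c, c' \in C$, $c \le c'$ and $c + c' = n$, and $s_C(x) = \max_{n \le x} R_C(n)$. $f \gg g$ means $g = O(f)$. *)

(* Defs.v *)
From HB Require Import structures.
From mathcomp Require Import all_boot all_order all_algebra.
From mathcomp Require Import finmap.
From mathcomp Require Import all_classical all_reals all_analysis.

Set Implicit Arguments.
Unset Strict Implicit.
Unset Printing Implicit Defensive.

Import Order.TTheory GRing.Theory Num.Theory.
Import numFieldNormedType.Exports.

Local Open Scope classical_set_scope.
Local Open Scope ring_scope.

(* Landau notations at +oo need a canonical [filter_on] structure on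
   [pinfty_nbhs], as declared for [eventually] in the library. *)
Canonical pinfty_filterType (R : numFieldType) := FilterType (pinfty_nbhs R) _.

Definition rep_pairs (C : set nat) (n : nat) : set (nat * nat) :=
  [set p | [/\ C p.1, C p.2, (p.1 <= p.2)%N & (p.1 + p.2 = n)%N]].

(* [fset_set] is only meaningful on finite sets. *)
Lemma finite_rep_pairs (C : set nat) (n : nat) : finite_set (rep_pairs C n).
Proof.
apply: (@sub_finite_set _ _ (`I_n.+1 `*` `I_n.+1)); last first.
  by apply: finite_setX; exact: finite_II.
by move=> [a b] [_ _ _ /= <-]; split; rewrite /= ltnS ?leq_addr ?leq_addl.
Qed.

Definition rep_count (C : set nat) (n : nat) : nat :=
  #|` fset_set (rep_pairs C n)|.

(* The maximum over the natural numbers n <= x; the bound on the index only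
   makes its range finite, as x < (Num.truncn x).+1%:R. *)
Definition max_rep_count (R : realType) (C : set nat) (x : R) : nat :=
  \max_(n < (Num.truncn x).+1 | n%:R <= x) rep_count C n.

Definition positive_cubes : set nat :=
  [set (n ^ 3)%N | n in [set n : nat | (1 <= n)%N]].

(* Main.v *)
Require Import Defs.
From mathcomp Require Import all_boot all_order all_algebra.
From mathcomp Require Import zify ring lra.
From mathcomp Require Import all_classical all_reals all_analysis.
Import Order.TTheory GRing.Theory Num.Theory.
Import numFieldNormedType.Exports.
Local Open Scope classical_set_scope.
Local Open Scope ring_scope.

(** The growth comes from the tangent construction on the curves
    X^3 + Y^3 = m.  The tangent at a rational point (x, y) with x > y > 0 meets
    the curve again at

      (x (x^3 + 2 y^3) / (x^3 - y^3), - y (2 x^3 + y^3) / (x^3 - y^3)),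

    which writes m as a difference of two positive cubes, and the tangent at
    that point leads back to a sum of two positive cubes as long as y / x is
    small ([double_tangent]).  One such double step increases y / x strictly,
    by a factor of at most 8.  So from (8^k, 1), on the curve with
    m = 8^(3k) + 1, one can take k steps; the k + 1 points are distinct because
    their ratios are.  The coordinates are handled homogeneously: a step maps
    the integers (x, y) to (x', y') with x'^3 + y'^3 = w^3 (x^3 + y^3).  After
    the last step every earlier point, scaled by the product of the later
    factors w, represents the same integer N as the last point (x_k, y_k), so
    N = x_k^3 + y_k^3 ([tangent_chain]).

    A step sends x to at most x^20, so N <= 2 (8^k)^(3 20^k) <= 2^(1024^k)
    while N has at least k + 1 representations ([many_representations]).  Given
    x, the largest k with 2^(1024^k) <= x satisfies x < 2^(1024^(k + 1)), hence
    ln (ln x) = O(k + 1), and k + 1 <= s_C(x). *)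

(** Here x^3 - y^3 is written e, which keeps the tangent formula at (x, y)
    free of subtraction. *)
Lemma tangent_sum_to_difference (x y e : nat) :
  (x ^ 3 = y ^ 3 + e ->
   (x * (3 * y ^ 3 + e)) ^ 3 =
   (y * (3 * y ^ 3 + 2 * e)) ^ 3 + (x ^ 3 + y ^ 3) * e ^ 3)%N.
Proof. by move=> xE; rewrite !expnMn xE; ring. Qed.

(** The tangent formula at (x, -y), with x^3 - 2 y^3 written d: the new point
    has positive coordinates exactly when d > 0. *)
Lemma tangent_difference_to_sum (x y d : nat) :
  (x ^ 3 = 2 * y ^ 3 + d ->
   (x * d) ^ 3 + (y * (3 * y ^ 3 + 2 * d)) ^ 3 =
   (y ^ 3 + d) * (3 * y ^ 3 + d) ^ 3)%N.
Proof. by move=> xE; rewrite !expnMn xE; ring. Qed.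

(** The condition y / x <= 1/8 guarantees Y / X <= 1/4 for the intermediate
    point (X, -Y), so X^3 > 2 Y^3 and the second tangent returns to the positive
    quadrant.  The first tangent multiplies the ratio by
    (2 x^3 + y^3) / (x^3 + 2 y^3), in ]1, 2], the second by
    (2 X^3 - Y^3) / (X^3 - 2 Y^3), in ]1, 4].  The strict growth of the ratio
    keeps successive points distinct, its upper bound allows iteration. *)
Lemma double_tangent (x y : nat) : (0 < y)%N -> (8 * y <= x)%N ->
  exists x' y' w : nat,
    [/\ (0 < y')%N, (x' ^ 3 + y' ^ 3 = w ^ 3 * (x ^ 3 + y ^ 3))%N,
        (x' * y < x * y')%N, (x * y' <= 8 * (x' * y))%N &
        (x' <= x ^ 20)%N].
Proof.
move=> y0 yx.
have b0 : (0 < y ^ 3)%N by rewrite expn_gt0 y0.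
have bx : (512 * y ^ 3 <= x ^ 3)%N.
  by rewrite (_ : 512 = 8 ^ 3)%N// -expnMn leq_exp2r.
have [e xE] : exists e, (x ^ 3 = y ^ 3 + e)%N by exists (x ^ 3 - y ^ 3)%N; lia.
pose X := (x * (3 * y ^ 3 + e))%N; pose Y := (y * (3 * y ^ 3 + 2 * e))%N.
have Y0 : (0 < Y)%N by rewrite /Y muln_gt0 y0; lia.
have YX : (4 * Y <= X)%N.
  apply: leq_trans (_ : 8 * y * (3 * y ^ 3 + e) <= X)%N; last first.
    by rewrite leq_mul2r yx orbT.
  by rewrite /Y; nia.
have XYE : (X ^ 3 = Y ^ 3 + (x ^ 3 + y ^ 3) * e ^ 3)%N.
  exact: tangent_sum_to_difference.
have lt_XY : (X * y < x * Y)%N.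
  have : (x * y * (3 * y ^ 3 + e) < x * y * (3 * y ^ 3 + 2 * e))%N.
    by rewrite ltn_mul2l muln_gt0; apply/andP; split; lia.
  by rewrite /X /Y; lia.
have le_XY : (x * Y <= 2 * (X * y))%N by rewrite /X /Y; lia.
have Xx5 : (X <= x ^ 5)%N.
  have : (3 * y ^ 3 + e <= x * x ^ 3)%N by nia.
  rewrite -expnS /X => le4.
  by rewrite (expnS x 4) leq_mul2l le4 orbT.
(* From here on only these bounds on X and Y matter, not their formulas. *)
move: X Y Y0 YX XYE lt_XY le_XY Xx5 => X Y Y0 YX XYE lt_XY le_XY Xx5.
have BX : (64 * Y ^ 3 <= X ^ 3)%N.
  by rewrite (_ : 64 = 4 ^ 3)%N// -expnMn leq_exp2r.
have [d XE] : exists d, (X ^ 3 = 2 * Y ^ 3 + d)%N.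
  by exists (X ^ 3 - 2 * Y ^ 3)%N; lia.
have B0 : (0 < Y ^ 3)%N by rewrite expn_gt0 Y0.
exists (X * d)%N, (Y * (3 * Y ^ 3 + 2 * d))%N, (e * (3 * Y ^ 3 + d))%N; split.
- by rewrite muln_gt0 Y0 addn_gt0 muln_gt0 B0.
- rewrite (tangent_difference_to_sum _ _ _ XE) (expnMn e).
  have -> : (Y ^ 3 + d = (x ^ 3 + y ^ 3) * e ^ 3)%N.
    by apply/(@addnI (Y ^ 3)%N); rewrite -XYE XE addnA addnn mul2n.
  by rewrite -mulnA mulnC.
- rewrite mulnAC mulnA.
  apply: (@leq_ltn_trans (X * y * (3 * Y ^ 3 + 2 * d))%N).
    by rewrite leq_mul2l; apply/orP; right; lia.
  by rewrite ltn_mul2r lt_XY andbT; lia.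
- have le4 : (3 * Y ^ 3 + 2 * d <= 4 * d)%N by lia.
  by have := leq_mul le_XY le4; lia.
- apply: (@leq_trans (X ^ 4)%N).
    by rewrite (expnS X 3) leq_mul2l XE leq_addl orbT.
  by rewrite (_ : 20 = 5 * 4)%N// expnM leq_exp2r.
Qed.

Definition cube_pair (N : nat) (p : nat * nat) : bool :=
  [&& (0 < p.1)%N, (p.1 <= p.2)%N & (p.1 ^ 3 + p.2 ^ 3 == N)%N].

(** Induction on the number of remaining steps, from the starting point: the
    chain of the next point (x', y') provides k + 1 pairs, to which a multiple
    of (x, y) is added.  The fourth clause, that all pairs have ratio at least
    y / x, is what separates this new pair from the others, whose ratios are
    at least y' / x' > y / x.  The bound on N is an upper bound for the sum of
    cubes at the last point of the chain. *)
Lemma tangent_chain (k x y : nat) : (0 < y)%N -> (8 ^ k * y <= x)%N ->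
  exists w (s : seq (nat * nat)),
    [/\ size s = k.+1, uniq s,
        {in s, forall p, cube_pair (w ^ 3 * (x ^ 3 + y ^ 3)) p},
        {in s, forall p, (p.2 * y <= x * p.1)%N} &
        (0 < w)%N /\ (w ^ 3 * (x ^ 3 + y ^ 3) <= 2 * x ^ (3 * 20 ^ k))%N].
Proof.
elim: k x y => [|k IH] x y y0 yx.
  rewrite expn0 mul1n in yx.
  exists 1%N, [:: (y, x)]; split => //.
  - move=> p; rewrite inE => /eqP ->.
    by rewrite /cube_pair/= y0 yx exp1n mul1n addnC eqxx.
  - by move=> p; rewrite inE => /eqP ->.
  - split => //; rewrite exp1n mul1n muln1.
    by have : (y ^ 3 <= x ^ 3)%N; [rewrite leq_exp2r|lia].
have e8 : (0 < 8 ^ k)%N by rewrite expn_gt0.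
have yx8 : (8 * y <= x)%N.
  by apply: leq_trans yx; rewrite expnS -mulnA leq_mul2l/= leq_pmull.
have [x' [y' [v [y'0 E lt_r le_r x'20]]]] := double_tangent _ _ y0 yx8.
have y'x' : (8 ^ k * y' <= x')%N.
  have x0 : (0 < x)%N by rewrite (leq_trans _ yx8)// muln_gt0.
  rewrite -(leq_pmul2l x0) mulnCA.
  apply: leq_trans (_ : 8 ^ k * (8 * (x' * y)) <= _)%N; first by rewrite leq_mul2l le_r orbT.
  apply: leq_trans (_ : (8 ^ k.+1 * y) * x' <= _)%N; first by rewrite expnS; lia.
  by rewrite leq_mul2r yx orbT.
have [w [s [sz us Ns rs [w0 le_N]]]] := IH _ _ y'0 y'x'.
have EN : (w ^ 3 * (x' ^ 3 + y' ^ 3) = (w * v) ^ 3 * (x ^ 3 + y ^ 3))%N.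
  by rewrite E mulnA expnMn.
rewrite EN in Ns le_N.
have v0 : (0 < v)%N.
  have : (0 < v ^ 3 * (x ^ 3 + y ^ 3))%N.
    by rewrite -E addn_gt0 !expn_gt0 y'0 orbT.
  by rewrite muln_gt0 expn_gt0 orbF => /andP[].
have wv0 : (0 < w * v)%N by rewrite muln_gt0 w0.
have rs' p : p \in s -> (p.2 * y < x * p.1)%N.
  move=> ps; have /and3P[p0 _ _] := Ns _ ps.
  rewrite -(ltn_pmul2r y'0) mulnAC.
  apply: (@leq_ltn_trans (x' * p.1 * y)%N); first by rewrite leq_mul2r rs// orbT.
  by rewrite mulnAC (mulnAC x) ltn_mul2r p0.
exists (w * v)%N, ((y * (w * v), x * (w * v))%N :: s); split.
- by rewrite /= sz.
- rewrite /= us andbT; apply/negP => /rs' /=.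
  by rewrite -mulnA (mulnC y) ltnn.
- move=> p; rewrite inE => /orP[/eqP ->|/Ns//].
  rewrite /cube_pair/= muln_gt0 y0 wv0/= leq_mul2r.
  rewrite (leq_trans _ yx8) ?leq_pmull// orbT/=.
  by rewrite (expnMn y) (expnMn x) -mulnDl mulnC addnC.
- move=> p; rewrite inE => /orP[/eqP ->|/rs' /ltnW//] /=.
  by rewrite -mulnA (mulnC y).
- split=> //; apply: leq_trans le_N _.
  rewrite leq_mul2l/= (_ : 3 * 20 ^ k.+1 = 20 * (3 * 20 ^ k))%N; last by rewrite expnS mulnCA.
  by rewrite (expnM x) leq_exp2r// muln_gt0 expn_gt0.
Qed.

Lemma size_le_rep_count (N : nat) (s : seq (nat * nat)) :
  uniq s -> {in s, forall p, cube_pair N p} ->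
  (size s <= rep_count positive_cubes N)%N.
Proof.
move=> us sN; pose cubes (p : nat * nat) := (p.1 ^ 3, p.2 ^ 3)%N.
have cubesI : injective cubes.
  by move=> [a b] [c d] [] /eqP + /eqP; rewrite !eqn_exp2r// => /eqP-> /eqP->.
rewrite -(size_map cubes); apply: uniq_leq_size; first by rewrite map_inj_uniq.
move=> _ /mapP[[a b] /sN /and3P[/= a0 ab /eqP abN] ->].
rewrite in_fset_set; last exact: finite_rep_pairs.
apply/mem_set; split => //=; [by exists a| |by rewrite leq_exp2r].
by exists b => //=; exact: leq_trans ab.
Qed.

(** The chain starting at (8^k, 1), the simplest point that allows k steps. *)
Lemma many_representations (k : nat) :
  exists2 N : nat, (N <= 2 ^ (1024 ^ k))%N &
    (k < rep_count positive_cubes N)%N.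
Proof.
have [|w [s [sz us sN _ [_ le_N]]]] := tangent_chain k (8 ^ k) 1 isT.
  by rewrite muln1.
exists (w ^ 3 * ((8 ^ k) ^ 3 + 1 ^ 3))%N; last by rewrite -sz size_le_rep_count.
apply: leq_trans le_N _.
rewrite (_ : 8 = 2 ^ 3)%N// -!expnM -expnS leq_exp2l//.
(* The exponent of 2 to be bounded is 1 + 9 k 20^k. *)
have h1 : (9 * k < 10 ^ k)%N by elim: k {sz us sN w s} => // k IH; rewrite expnS; lia.
have h2 : (0 < 20 ^ k)%N by rewrite expn_gt0.
apply: (@leq_trans (10 ^ k * 20 ^ k)%N); last first.
  by case: (k) => // j; rewrite -expnMn leq_exp2r.
apply: (@leq_trans ((9 * k).+1 * 20 ^ k)%N); last by rewrite leq_mul2r h1 orbT.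
move: (20 ^ k)%N h2 => a a0; lia.
Qed.

Lemma max_rep_count_gt (R : realType) (k : nat) (x : R) :
  ((2 ^ (1024 ^ k))%N%:R <= x) -> (k < max_rep_count positive_cubes x)%N.
Proof.
have [N leN ltk] := many_representations k.
move=> le_x; have Nx : N%:R <= x by rewrite (le_trans _ le_x)// ler_nat.
apply: leq_trans ltk _.
have NT : (N < (Num.truncn x).+1)%N.
  by rewrite ltnS truncn_ge_nat// (le_trans _ Nx)// ler0n.
exact: (@leq_bigmax_cond _ _ _ (Ordinal NT) Nx).
Qed.

(** From ln b <= b - 1.  It serves twice below, with b = 2 to bound ln x and
    with b = 1024 to bound ln (ln x). *)
Lemma ln_le_of_le_exp (R : realType) (b x : R) (n : nat) :
  0 < b -> 0 < x -> x <= b ^+ n -> ln x <= (b - 1) * n%:R.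
Proof.
move=> b0 x0 xbn; apply: (@le_trans _ _ (ln (b ^+ n))).
  by rewrite ler_ln ?posrE ?exprn_gt0.
rewrite lnXn// mulr_natr; apply: ler_wMn2r.
by rewrite -ler_expR lnK ?posrE// (le_trans _ (expR_ge1Dx _))// addrC subrK.
Qed.

Lemma lnln_le_max_rep_count (R : realType) (x : R) : expR 1 <= x ->
  ln (ln x) <= 1024 * (max_rep_count positive_cubes x)%:R.
Proof.
move=> ex.
have x2 : 2 <= x by apply: le_trans ex; exact: expR_ge1Dx.
have lnx1 : 1 <= ln x by rewrite -[leLHS]expRK ler_ln ?posrE ?expR_gt0//; lra.
have lnx0 : 0 < ln x by lra.
have x0 : 0 < x by lra.
have le1024 : (1024 - 1 : R) <= 1024 by lra.
have tower : exists j, (Num.truncn x < 2 ^ (1024 ^ j))%N.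
  exists (Num.truncn x); apply: (ltn_trans (ltn_expl _ (isT : 1 < 1024)%N)).
  exact: ltn_expl.
(* The least such j is positive as x >= 2; its predecessor is the k wanted. *)
case: (ex_minnP tower) => -[|k] xk min_k.
  by move: xk; rewrite ltnNge expn0 expn1 truncn_ge_nat ?x2//; lra.
have kx : (2 ^ (1024 ^ k))%N%:R <= x.
  rewrite -truncn_ge_nat ?ltW//.
  by rewrite leqNgt; apply/negP => /min_k; rewrite ltnn.
have x_lt_next : x < (2 ^ (1024 ^ k.+1))%N%:R.
  by rewrite -truncn_lt_nat// ltW.
have lnx : ln x <= 1024 ^+ k.+1.
  rewrite -natrX.
  move: (1024 ^ k.+1)%N x_lt_next => n; rewrite natrX => /ltW x2n.
  have := @ln_le_of_le_exp R 2 x n; rewrite (_ : 2 - 1 = 1) ?mul1r; last by lra.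
  by apply; rewrite ?ltr0n.
apply: (@le_trans _ _ ((1024 - 1) * k.+1%:R)).
  by apply: ln_le_of_le_exp lnx0 lnx; rewrite ltr0n.
apply: (le_trans (ler_wpM2r (ler0n _ _) le1024)).
by rewrite ler_pM2l ?ltr0n// ler_nat max_rep_count_gt.
Qed.

Theorem theorem8 (R : realType) :
  (fun x : R => ln (ln x)) =O_+oo
  (fun x : R => (max_rep_count positive_cubes x)%:R : R).
Proof.
apply/eqO_exP; exists 1024; first by rewrite ltr0n.
near=> x.
have ex : expR 1 <= x by near: x; exact: nbhs_pinfty_ge.
have lnx1 : 1 <= ln x.
  by rewrite -[leLHS]expRK ler_ln ?posrE ?expR_gt0// (lt_le_trans _ ex) ?expR_gt0.
by rewrite ger0_norm ?ln_ge0// normr_nat lnln_le_max_rep_count.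
Unshelve. all: by end_near.
Qed.
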